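(* Let $G$ be a graph on $n$ vertices and let $\frac{1}{2}<\alpha<1$. Then $$\lambda_n(A_{\alpha}(G))\leq \alpha n-1,$$ with equality if and only if $G\cong K_{n}$.
   Context: All graphs are finite, simple and undirected. For a graph $G$ with adjacency matrix $A(G)$ and diagonal degree matrix $D(G)$, and a real $\alpha\in[0,1]$, $A_{\alpha}(G)=\alpha D(G)+(1-\alpha)A(G)$. Its eigenvalues are denoted $\lambda_1(A_\alpha(G))\geq\cdots\geq\lambda_n(A_\alpha(G))$.
   Formalization: The graph is assumed to have n ≥ 2 vertices; for n = 1 the claim is false, since A_α(K_1) = [0] gives λ_1 = 0 > α − 1. *)

(* Defs.v *)
From mathcomp Require Import all_boot all_order all_algebra.
From mathcomp Require Import reals.
From mathcomp Require Import polyrcf.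

Set Implicit Arguments.
Unset Strict Implicit.
Unset Printing Implicit Defensive.

Import Order.TTheory GRing.Theory Num.Theory.
Local Open Scope ring_scope.

Record sgraph := SGraph {
  vertex :> finType;
  adj : rel vertex;
  adj_sym : symmetric adj;
  adj_irrefl : irreflexive adj }.

Definition degree (G : sgraph) (v : G) : nat := #|[set w : G | adj v w]|.

Definition isomorphic (G H : sgraph) : Prop :=
  exists2 f : G -> H, bijective f & forall u v, adj (f u) (f v) = adj u v.

Definition complete_adj n : rel 'I_n := fun i j => i != j.

Lemma complete_sym n : symmetric (@complete_adj n).
Proof. by move=> i j; rewrite /complete_adj eq_sym. Qed.

Lemma complete_irrefl n : irreflexive (@complete_adj n).
Proof. by move=> i; rewrite /complete_adj eqxx. Qed.

Definition complete_graph (n : nat) : sgraph :=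
  SGraph (@complete_sym n) (@complete_irrefl n).

(* The vertices are numbered by the canonical enumeration of the vertex type. *)
Definition adj_mx (R : realType) (G : sgraph) : 'M[R]_#|G| :=
  \matrix_(i, j) (adj (enum_val i) (enum_val j))%:R.

Definition degree_mx (R : realType) (G : sgraph) : 'M[R]_#|G| :=
  diag_mx (\row_i (degree (enum_val i))%:R).

Definition Aalpha (R : realType) (alpha : R) (G : sgraph) : 'M[R]_#|G| :=
  alpha *: degree_mx R G + (1 - alpha) *: adj_mx R G.

(* The real eigenvalues of A in nonincreasing order, each repeated according
   to its multiplicity as a root of the characteristic polynomial; when A is
   symmetric this list has length m. *)
Definition eigenvalues (R : realType) m (A : 'M[R]_m) : seq R :=
  sort (fun x y => y <= x)
    (flatten [seq nseq (mup x (char_poly A)) x | x <- rootsR (char_poly A)]).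

(* Indices start at 1: [lambda 1 A] is the largest eigenvalue and, for A
   symmetric of size m > 0, [lambda m A] is the least one. *)
Definition lambda (R : realType) (k : nat) m (A : 'M[R]_m) : R :=
  nth 0 (eigenvalues A) k.-1.

(* Main.v *)
(** The least eigenvalue of a symmetric matrix is at most each of its diagonal
    entries, so lambda_n(A_alpha(G)) <= alpha * delta for the minimum degree
    delta. If G is not complete then delta <= n - 2, and alpha (n - 2) <
    alpha n - 1 because alpha > 1/2. If G is complete then A_alpha(G) =
    (alpha n - 1) I + (1 - alpha) J with J the all-ones matrix, which is
    positive semidefinite and singular, so the least eigenvalue is exactly
    alpha n - 1. *)
Require Import Defs.
From mathcomp Require Import all_boot all_order all_algebra.
From mathcomp Require Import reals.
From mathcomp Require Import polyrcf complex spectral ring lra.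

Set Implicit Arguments.
Unset Strict Implicit.
Unset Printing Implicit Defensive.

Import Order.TTheory GRing.Theory Num.Theory.
Local Open Scope ring_scope.

Lemma char_poly_similar (F : comUnitRingType) m (P B : 'M[F]_m) :
  P \in unitmx -> char_poly (invmx P *m B *m P) = char_poly B.
Proof.
move=> P_unit; pose Pc : 'M[{poly F}]_m := map_mx polyC P.
pose Qc : 'M[{poly F}]_m := map_mx polyC (invmx P).
have QP : Qc *m Pc = 1%:M by rewrite -map_mxM mulVmx // map_mx1.
rewrite /char_poly.
have -> : char_poly_mx (invmx P *m B *m P) = Qc *m char_poly_mx B *m Pc.
  rewrite /char_poly_mx mulmxBr mulmxBl !map_mxM; congr (_ - _).
  by rewrite mul_mx_scalar -scalemxAl QP scalemx1.
by rewrite !det_mulmx mulrAC -det_mulmx QP det1 mul1r.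
Qed.

(* With A = P^* D P and P unitary, the diagonal entry A i i is the average of
   the eigenvalues D j j with the weights |P j i|^2. *)
Lemma symmetric_char_poly_diag (R : rcfType) m (A : 'M[R]_m) : A^T = A ->
  exists2 d : 'I_m -> R, char_poly A = \prod_i ('X - (d i)%:P)
    & forall c, (forall i, c <= d i) -> forall i, c <= A i i.
Proof.
(* The spectral theorem is applied over the complex numbers, where [A] becomes Hermitian. The
   spectrum is real, so it descends to [R] by taking real parts. *)
move=> A_sym; pose iota := real_complex R; pose B := map_mx iota A.
have B_herm : B \is hermsymmx.
  apply/is_hermitianmxP; rewrite expr0 scale1r; apply/matrixP=> i j.
  have := congr1 (fun M : 'M_m => M i j) A_sym; rewrite !mxE => <-; apply/esym/CrealP.
  by apply/complex_realP; exists (A j i).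
have /mxOverP d_real := hermitian_spectral_diag_real B_herm.
have /hermitian_normalmx/orthomx_spectralP B_eq := B_herm.
set P := spectralmx B in B_eq; set d := spectral_diag B in d_real B_eq.
have P_unitary : P \is unitarymx by exact: spectral_unitarymx.
have dE i : iota (complex.Re (d 0 i)) = d 0 i by exact: RRe_real.
exists (fun i => complex.Re (d 0 i)).
  apply: (@map_poly_inj _ _ iota); rewrite map_char_poly -/B B_eq.
  rewrite char_poly_similar ?unitarymx_unit // char_poly_trig ?diag_mx_is_trig //.
  rewrite rmorph_prod; apply: eq_bigr => i _.
  rewrite mxE eqxx mulr1n -dE; exact/esym/map_polyXsubC.
move=> c c_le i; rewrite -lecR -/iota.
have AE : iota (A i i) = \sum_j `|P j i| ^+ 2 * d 0 j.
  have -> : iota (A i i) = B i i by rewrite mxE.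
  rewrite [in LHS]B_eq invmx_unitary // !mxE; apply: eq_bigr => j _.
  rewrite mul_mx_diag !mxE normCK; ring.
(* Each column of a unitary matrix has norm 1, so the weights form a convex combination. *)
have P_sum : \sum_j `|P j i| ^+ 2 = 1.
  have : ((P ^t Num.conj)%sesqui *m P) i i = 1%:M i i.
    by rewrite -invmx_unitary // mulVmx ?unitarymx_unit.
  rewrite !mxE eqxx mulr1n => <-; apply: eq_bigr => j _.
  by rewrite !mxE normCKC.
rewrite AE -[iota c]mul1r -P_sum mulr_suml ler_sum // => j _.
by rewrite ler_wpM2l ?exprn_ge0 // -dE lecR.
Qed.

(** The multiplicity of a root of a split polynomial is its count in [s], so [eigenvalues A] is [s]
    regrouped by value and sorted. *)
Lemma perm_eigenvalues (R : realType) m (A : 'M[R]_m) (s : seq R) :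
  char_poly A = \prod_(x <- s) ('X - x%:P) -> perm_eq (eigenvalues A) s.
Proof.
move=> sE; rewrite /eigenvalues perm_sort.
rewrite (eq_map (g := fun x => nseq (count_mem x s) x)); last first.
  by move=> x; rewrite sE mu_prod_XsubC.
rewrite -(permPr (perm_count_undup s)); apply/perm_flatten/perm_map.
apply: uniq_perm; [exact: uniq_roots | exact: undup_uniq | move=> x].
have := roots_on_rootsR (monic_neq0 (char_poly_monic A)) x.
by rewrite in_itv /= mem_undup => <-; rewrite sE root_prod_XsubC.
Qed.

Lemma lambda_last (R : realType) m (A : 'M[R]_m) (d : 'I_m -> R) : (0 < m)%N ->
  char_poly A = \prod_i ('X - (d i)%:P) ->
  (exists i, lambda m A = d i) /\ forall i, lambda m A <= d i.
Proof.
move=> m_gt0 dE; pose s := [seq d i | i : 'I_m].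
have s_perm : perm_eq (eigenvalues A) s.
  by apply: perm_eigenvalues; rewrite dE big_map big_enum.
have size_ev : size (eigenvalues A) = m.
  by rewrite (perm_size s_perm) size_map size_enum_ord.
(* As [m > 0], the index falls inside the list and [lambda m A] is a true entry, not the default
   0. *)
have last_lt : (m.-1 < size (eigenvalues A))%N by rewrite size_ev prednK.
split.
  have : lambda m A \in s by rewrite -(perm_mem s_perm) mem_nth.
  by case/mapP=> i _ ->; exists i.
move=> i; have : d i \in eigenvalues A.
  by rewrite (perm_mem s_perm); apply: map_f; rewrite mem_enum.
move/(nthP 0) => [k k_lt <-].
have ge_trans : transitive (fun x y : R => y <= x).
  by move=> y x z yx zy; apply: le_trans zy yx.
have ge_refl : reflexive (fun x y : R => y <= x) by move=> x; exact: lexx.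
apply: (sorted_leq_nth ge_trans ge_refl) => //.
  by apply: sort_sorted => x y; rewrite orbC le_total.
by rewrite -ltnS prednK // -size_ev.
Qed.

Lemma lambda_last_eigenvalue (R : realType) m (A : 'M[R]_m) :
  (0 < m)%N -> A^T = A -> eigenvalue A (lambda m A).
Proof.
move=> m_gt0 A_sym; have [d dE _] := symmetric_char_poly_diag A_sym.
have [[i ->] _] := lambda_last m_gt0 dE.
by rewrite eigenvalue_root_char dE (bigD1 i) //= rootM root_XsubC eqxx.
Qed.

Lemma lambda_last_le_eigenvalue (R : realType) m (A : 'M[R]_m) a :
  (0 < m)%N -> A^T = A -> eigenvalue A a -> lambda m A <= a.
Proof.
move=> m_gt0 A_sym; have [d dE _] := symmetric_char_poly_diag A_sym.
have [_ le_d] := lambda_last m_gt0 dE.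
rewrite eigenvalue_root_char dE -(big_map d xpredT (fun x => 'X - x%:P)).
by rewrite root_prod_XsubC => /mapP[i _ ->].
Qed.

Lemma lambda_last_le_diag (R : realType) m (A : 'M[R]_m) i :
  (0 < m)%N -> A^T = A -> lambda m A <= A i i.
Proof.
move=> m_gt0 A_sym; have [d dE d_diag] := symmetric_char_poly_diag A_sym.
by have [_ le_d] := lambda_last m_gt0 dE; apply: d_diag.
Qed.

Lemma AalphaE (R : realType) (alpha : R) (G : sgraph) i j :
  Aalpha alpha G i j = (alpha * (degree (enum_val i))%:R) *+ (i == j)
                       + (1 - alpha) * (adj (enum_val i) (enum_val j))%:R.
Proof. by rewrite !mxE -mulrnAr. Qed.

Lemma Aalpha_diag (R : realType) (alpha : R) (G : sgraph) i :
  Aalpha alpha G i i = alpha * (degree (enum_val i))%:R.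
Proof. by rewrite AalphaE eqxx adj_irrefl mulr0 addr0. Qed.

Lemma Aalpha_sym (R : realType) (alpha : R) (G : sgraph) :
  (Aalpha alpha G)^T = Aalpha alpha G.
Proof.
apply/matrixP=> i j; rewrite mxE !AalphaE adj_sym eq_sym.
by case: eqVneq => // ->.
Qed.

Definition is_complete (G : sgraph) :=
  [forall u : G, forall v : G, adj u v == (u != v)].

Lemma is_completeP (G : sgraph) :
  reflect (forall u v : G, adj u v = (u != v)) (is_complete G).
Proof.
by apply: (iffP forallP) => cG u; [apply/eqfunP | apply/eqfunP => v]; exact: cG.
Qed.

(** Makes the equality case decidable. Any bijection onto the ordinals is an isomorphism here, and
    [enum_rank] provides one. *)
Lemma isomorphic_completeP (G : sgraph) :
  reflect (isomorphic G (complete_graph #|G|)) (is_complete G).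
Proof.
apply: (iffP (is_completeP G)) => [cG|[f /bij_inj f_inj fE] u v].
  exists (@enum_rank G) => [|u v]; first exact: enum_rank_bij.
  by rewrite cG -(inj_eq enum_rank_inj).
by rewrite -fE -(inj_eq f_inj).
Qed.

Lemma degree_complete (G : sgraph) (u : G) : is_complete G -> degree u = #|G|.-1.
Proof.
move=> /is_completeP cG; rewrite -(cardsC1 u); apply: eq_card => v.
by rewrite !inE cG eq_sym.
Qed.

Lemma degree_non_complete (G : sgraph) :
  ~~ is_complete G -> exists u : G, ((degree u).+2 <= #|G|)%N.
Proof.
case/forallPn=> u /forallPn[v]; have [<-|uv] := eqVneq u v.
  by rewrite adj_irrefl.
rewrite eqb_id => nadj; exists u.
(* The vertex [u], its non-neighbour [v] and the neighbourhood of [u] are pairwise disjoint. *)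
have -> : (degree u).+2 = #|u |: (v |: [set w : G | adj u w])|.
  by rewrite !cardsU1 !inE (negbTE uv) adj_irrefl (negbTE nadj).
exact: max_card.
Qed.

Lemma lambda_Aalpha_complete (R : realType) (alpha : R) (G : sgraph) :
  (1 < #|G|)%N -> alpha <= 1 -> is_complete G ->
  lambda #|G| (Aalpha alpha G) = alpha * #|G|%:R - 1.
Proof.
move=> G_gt1 alpha_le1 cG; have G_gt0 : (0 < #|G|)%N by exact: ltnW.
set c := alpha * _ - 1.
have GE : (#|G|.-1)%:R = #|G|%:R - 1 :> R by rewrite -subn1 natrB.
have AE : Aalpha alpha G = c%:M + const_mx (1 - alpha).
  apply/matrixP=> i j; rewrite AalphaE degree_complete // GE !mxE.
  move/is_completeP/(_ (enum_val i) (enum_val j)): cG => ->.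
  rewrite (inj_eq enum_val_inj) /c.
  by case: (i == j); rewrite ?mulr1n ?mulr0n /=; ring.
(* The all-ones matrix sends a row vector to the constant vector of its coordinate sum. *)
have vA (v : 'rV[R]_#|G|) :
    v *m Aalpha alpha G = c *: v + const_mx ((1 - alpha) * \sum_i v 0 i).
  rewrite AE mulmxDr mul_mx_scalar; congr (_ + _); apply/rowP=> j.
  by rewrite !mxE mulr_sumr; apply: eq_bigr => i _; rewrite mxE mulrC.
apply: le_anti; apply/andP; split.
  apply: lambda_last_le_eigenvalue => //; first exact: Aalpha_sym.
  pose i0 := Ordinal G_gt0; pose i1 := Ordinal G_gt1.
  (* This vector has coordinate sum 0, so it is an eigenvector for [c]; two distinct vertices are
     needed to form it. *)
  apply/eigenvalueP; exists (delta_mx 0 i0 - delta_mx 0 i1).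
    rewrite vA (_ : \sum_i _ = 0) ?mulr0 ?addr0 //.
    under eq_bigr do rewrite !mxE /=.
    have sum_delta (k : 'I_#|G|) : \sum_i (i == k)%:R = 1 :> R.
      by rewrite (bigD1 k) //= eqxx big1 ?addr0 // => i /negPf ->.
    by rewrite sumrB !sum_delta subrr.
  apply/eqP=> /rowP/(_ i0); rewrite !mxE /= subr0 => /eqP.
  by rewrite oner_eq0.
have /eigenvalueP[v vE v_neq0] := lambda_last_eigenvalue G_gt0 (Aalpha_sym alpha G).
(* Instead of a quadratic form, the lower bound uses an eigenvector: an eigenvalue [x < c] would
   force [v = 0]. *)
rewrite leNgt; apply: contra v_neq0; set x := lambda _ _ in vE * => x_lt.
have {}vE j : (c - x) * v 0 j = - ((1 - alpha) * \sum_i v 0 i).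
  by move: vE; rewrite vA => /rowP/(_ j); rewrite !mxE => /eqP; lra.
(* Summing the identities [vE] over j gives (c - x + n (1 - alpha)) * sum v = 0. *)
have v_sum : \sum_i v 0 i = 0.
  have /lt0r_neq0/negPf c_neq0 : 0 < c - x + #|G|%:R * (1 - alpha).
    by rewrite ltr_wpDr ?subr_gt0 // mulr_ge0 ?subr_ge0.
  apply/eqP; rewrite -[_ == 0]/(false || _) -c_neq0 -mulf_eq0 mulrDl mulr_sumr.
  under eq_bigr do rewrite vE.
  by rewrite sumr_const card_ord -mulr_natl; apply/eqP; ring.
apply/eqP/rowP=> j; rewrite mxE; have /eqP := vE j.
by rewrite v_sum mulr0 oppr0 mulf_eq0 subr_eq0 gt_eqF //= => /eqP.
Qed.

Lemma lambda_Aalpha_non_complete (R : realType) (alpha : R) (G : sgraph) :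
  1 / 2 < alpha -> ~~ is_complete G ->
  lambda #|G| (Aalpha alpha G) < alpha * #|G|%:R - 1.
Proof.
move=> alpha_gt /degree_non_complete[u u_deg].
have G_gt0 : (0 < #|G|)%N by apply: leq_trans u_deg.
have := lambda_last_le_diag (enum_rank u) G_gt0 (Aalpha_sym alpha G).
rewrite Aalpha_diag enum_rankK => /le_lt_trans; apply.
have : (degree u).+2%:R <= #|G|%:R :> R by rewrite ler_nat.
(* Since [alpha] is positive, alpha * deg(u) <= alpha * n - 2 * alpha, and 2 * alpha > 1. *)
rewrite -addn2 natrD; nra.
Qed.

Theorem theorem4p4 (R : realType) (G : sgraph) (n : nat) (alpha : R)
    (hn : #|G| = n) (n_gt1 : (1 < n)%N)
    (alpha_gt : 1 / 2 < alpha) (alpha_lt : alpha < 1) :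
  lambda n (Aalpha alpha G) <= alpha * n%:R - 1 /\
  (lambda n (Aalpha alpha G) = alpha * n%:R - 1 <->
   isomorphic G (complete_graph n)).
Proof.
case: n / hn n_gt1 => G_gt1.
(* Equality holds in the complete case and strict inequality in the other, which settles both the
   bound and the equivalence. *)
have [cG|ncG] := boolP (is_complete G).
  rewrite (lambda_Aalpha_complete G_gt1 (ltW alpha_lt) cG); split=> //.
  by split=> // _; apply/isomorphic_completeP.
have lt := lambda_Aalpha_non_complete alpha_gt ncG; split; first exact: ltW.
split=> [eq|/isomorphic_completeP]; last by rewrite (negbTE ncG).
by rewrite eq ltxx in lt.
Qed.
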